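(* Let $(X,G)$ be a compact $G$-space. (i) If every group $*$-closed in $X$ is solvable-by-finite, then every ring with identity or of finite characteristic which is $*$-closed in $X$ is nilpotent-by-finite. Likewise, if every group $*$-closed in $X^{teq}$ is solvable-by-finite, then every ring with identity or of finite characteristic which is $*$-closed in $X^{teq}$ is nilpotent-by-finite. (ii) If every nilpotent group $*$-closed in $X$ is abelian-by-finite, then every ring $*$-closed in $X$ is null-by-finite. Likewise, if every nilpotent group $*$-closed in $X^{teq}$ is abelian-by-finite, then every ring $*$-closed in $X^{teq}$ is null-by-finite.
   Context: A compact $G$-space is a pair $(X,G)$ where $X$ is a compact Hausdorff space and $G$ is a Polish group acting faithfully and continuously on $X$ (stabilizers of points being closed). For a finite $A\subseteq X$, $G_A$ denotes the pointwise stabilizer of $A$; a subset $D\subseteq X^n$ is $A$-closed if it is closed and $G_A$-invariant, and $*$-closed if it is $A$-closed for some finite $A$. $X^{teq}$ is the disjoint union of the spaces $X^n/E$ (with quotient topology and induced $G$-action), where $E$ ranges over all $\emptyset$-closed equivalence relations on $X^n$, $n\ge1$; $*$-closed subsets of products of such sorts are defined analogously. A group (ring) is $*$-closed in $X$ [in $X^{teq}$] if its universe and the graphs of its operations (group operation; resp. addition and multiplication) are $*$-closed in $X$ [in $X^{teq}$]. Rings are associative, not necessarily with $1$ or commutative. A group is abelian-by-finite [solvable-by-finite] if it has a normal abelian [solvable] subgroup of finite index; a ring is null-by-finite [nilpotent-by-finite] if it has an ideal $I$ of finite index with $I\cdot I=\{0\}$ [with $I$ nilpotent]. *)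

(* Defs.v *)
From HB Require Import structures.
From mathcomp Require Import all_boot all_order all_algebra generic_quotient.
From mathcomp Require Import all_classical all_reals all_analysis.

Set Implicit Arguments.
Unset Strict Implicit.
Unset Printing Implicit Defensive.

Local Open Scope classical_set_scope.

(* Associative rings, not necessarily commutative or with 1. *)
HB.mixin Record Zmodule_isNonUnitalRing R & GRing.Zmodule R := {
  numul : R -> R -> R;
  numulA : associative numul;
  numulDl : left_distributive numul +%R;
  numulDr : right_distributive numul +%R
}.

#[short(type="nonUnitalRingType")]
HB.structure Definition NonUnitalRing :=
  {R of GRing.Zmodule R & Zmodule_isNonUnitalRing R}.

HB.mixin Record isTopGroup G & Group G & Topological G := {
  mulg_continuous : continuous (fun p : G * G => (p.1 * p.2)%g);
  invg_continuous : continuous (fun x : G => (x^-1)%g)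
}.

#[short(type="topGroupType")]
HB.structure Definition TopGroup :=
  {G of Group G & Topological G & isTopGroup G}.

Section Groups.
Local Open Scope group_scope.
Variable H : groupType.
Implicit Types A B N : set H.

Definition subgroup N :=
  [/\ N 1, (forall x y, N x -> N y -> N (x * y)) &
      (forall x, N x -> N x^-1)].

Definition normal_subgroup N :=
  subgroup N /\ (forall x y, N x -> N (x ^ y)).

Definition finite_index N :=
  finite_set [set [set x * h | h in N] | x in [set: H]].

Definition abelian_subset N := forall x y, N x -> N y -> x * y = y * x.

(* The commutator subgroup [A, B], generated by the [~ a, b]. *)
Definition commutator A B : set H :=
  smallest subgroup [set [~ a, b] | a in A & b in B].

Definition solvable_subset N :=
  exists n, iter n (fun A => commutator A A) N = [set 1].

Definition nilpotent_group :=
  exists n, iter n (fun A => commutator A [set: H]) [set: H] = [set 1].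

Definition abelian_by_finite :=
  exists N, [/\ normal_subgroup N, abelian_subset N & finite_index N].

Definition solvable_by_finite :=
  exists N, [/\ normal_subgroup N, solvable_subset N & finite_index N].
End Groups.

Section Rings.
Local Open Scope ring_scope.
Variable R : nonUnitalRingType.
Implicit Types I J : set R.

Definition additive_subgroup I :=
  [/\ I 0, (forall x y, I x -> I y -> I (x + y)) & (forall x, I x -> I (- x))].

Definition ideal I :=
  additive_subgroup I /\
  (forall r x, I x -> I (numul r x) /\ I (numul x r)).

Definition finite_index_ideal I :=
  finite_set [set [set x + h | h in I] | x in [set: R]].

(* The product I . J of ideals: the finite sums of products. *)
Definition ideal_mul I J : set R :=
  smallest additive_subgroup [set numul x y | x in I & y in J].

(* The n-th iterate below is the power I^(n+1). *)
Definition nilpotent_ideal I :=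
  exists n, iter n (fun J => ideal_mul J I) I = [set 0].

Definition null_by_finite :=
  exists I, [/\ ideal I, ideal_mul I I = [set 0] & finite_index_ideal I].

Definition nilpotent_by_finite :=
  exists I, [/\ ideal I, nilpotent_ideal I & finite_index_ideal I].

Definition has_identity :=
  exists e : R, forall x, numul e x = x /\ numul x e = x.

Definition finite_characteristic :=
  exists2 n, (0 < n)%N & forall x : R, x *+ n = 0.
End Rings.

Definition separable_space (T : topologicalType) :=
  exists2 D : set T, countable D & dense D.

Definition completely_metrizable (R : realType) (T : topologicalType) :=
  exists (M : metricType R) (f : T -> M) (g : M -> T),
    [/\ cancel f g, cancel g f, continuous f, continuous g &
        forall F : set_system M, ProperFilter F -> cauchy F ->
          exists x : M, F --> x].

Definition polish (R : realType) (T : topologicalType) :=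
  separable_space T /\ completely_metrizable R T.

Record compact_G_space (R : realType) (X : topologicalType) (G : topGroupType)
    (act : G -> X -> X) : Prop := CompactGSpace {
  cgs_polish : polish R G;
  cgs_compact : compact [set: X];
  cgs_hausdorff : hausdorff_space X;
  cgs_act1 : forall x, act 1%g x = x;
  cgs_actM : forall g h x, act (g * h)%g x = act g (act h x);
  cgs_continuous : continuous (fun p : G * X => act p.1 p.2);
  cgs_faithful : forall g, (forall x, act g x = x) -> g = 1%g;
  (* implied by the other fields *)
  cgs_stab_closed : forall x, closed [set g | act g x = x]
}.

(* Below [Y] is the universe the parameters are taken from and [S] the space in
   which the set [D] lives. *)
Section StarClosed.
Variables (G : topGroupType) (Y : Type) (actY : G -> Y -> Y).

Definition pointwise_stabilizer (A : set Y) : set G :=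
  [set g | forall a, A a -> actY g a = a].

Definition closed_over (A : set Y) (S : topologicalType) (actS : G -> S -> S)
    (D : set S) :=
  closed D /\
  (forall g x, pointwise_stabilizer A g -> D x -> D (actS g x)).

Definition star_closed (S : topologicalType) (actS : G -> S -> S)
    (D : set S) :=
  exists2 A : set Y, finite_set A & closed_over A actS D.

Definition diag2 (S : Type) (actS : G -> S -> S) (g : G) (p : S * S) : S * S :=
  (actS g p.1, actS g p.2).

Definition diag3 (S : Type) (actS : G -> S -> S) (g : G) (p : S * S * S)
    : S * S * S :=
  (actS g p.1.1, actS g p.1.2, actS g p.2).

(* The graph of the operation [op] on [T], where [u] identifies [T] with a
   subset of [S]. *)
Definition op_graph (T S : Type) (u : T -> S) (op : T -> T -> T)
    : set (S * S * S) :=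
  [set p | exists x y, p = (u x, u y, u (op x y))].

Definition star_closed_group_in (S : topologicalType) (actS : G -> S -> S)
    (H : groupType) (u : H -> S) :=
  [/\ injective u,
      star_closed actS (range u) &
      star_closed (diag3 actS) (op_graph u (fun x y => (x * y)%g))].

Definition star_closed_ring_in (S : topologicalType) (actS : G -> S -> S)
    (R : nonUnitalRingType) (u : R -> S) :=
  [/\ injective u,
      star_closed actS (range u),
      star_closed (diag3 actS) (op_graph u +%R) &
      star_closed (diag3 actS) (op_graph u numul)].
End StarClosed.

Section InX.
Variables (G : topGroupType) (X : topologicalType) (act : G -> X -> X).

Definition pow_space (n : nat) : topologicalType := {ptws 'I_n -> X}.

Definition pow_act (n : nat) (g : G) (x : pow_space n) : pow_space n :=
  fun i => act g (x i).

Definition star_closed_group (H : groupType) :=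
  exists (n : nat) (u : H -> pow_space n),
    star_closed_group_in act (@pow_act n) u.

Definition star_closed_ring (R : nonUnitalRingType) :=
  exists (n : nat) (u : R -> pow_space n),
    star_closed_ring_in act (@pow_act n) u.

Record teq_sort := TeqSort {
  sort_arity : nat;
  sort_arity_gt0 : (0 < sort_arity)%N;
  sort_rel : equiv_rel (pow_space sort_arity);
  sort_rel_closed : closed_over act set0 (diag2 (@pow_act sort_arity))
    [set p : pow_space sort_arity * pow_space sort_arity | sort_rel p.1 p.2]
}.

Definition sort_space (s : teq_sort) : topologicalType :=
  quotient_topology {eq_quot (sort_rel s)}%qT.

(* Independent of the representative, by invariance of the relation. *)
Definition sort_act (s : teq_sort) (g : G) (q : sort_space s) : sort_space s :=
  (\pi_(sort_space s) (pow_act g (repr q)))%qT.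

Definition teq : Type := {s : teq_sort & sort_space s}.

Definition teq_act (g : G) (a : teq) : teq :=
  Tagged sort_space (sort_act g (tagged a)).

Definition sort_prod (k : nat) (s : 'I_k -> teq_sort) : topologicalType :=
  prod_topology (fun i => sort_space (s i)).

Definition sort_prod_act (k : nat) (s : 'I_k -> teq_sort) (g : G)
    (x : sort_prod s) : sort_prod s :=
  fun i => sort_act g (x i).

Definition teq_star_closed_group (H : groupType) :=
  exists (k : nat) (s : 'I_k -> teq_sort) (u : H -> sort_prod s),
    star_closed_group_in teq_act (@sort_prod_act k s) u.

Definition teq_star_closed_ring (R : nonUnitalRingType) :=
  exists (k : nat) (s : 'I_k -> teq_sort) (u : R -> sort_prod s),
    star_closed_ring_in teq_act (@sort_prod_act k s) u.
End InX.

(* Main.v *)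
Require Import Defs.
From HB Require Import structures.
From mathcomp Require Import all_boot all_order all_algebra generic_quotient.
From mathcomp Require Import all_classical all_reals all_analysis.

(** Let [K] be a *-closed ring. Graphs of ring terms are obtained from those of
    addition and multiplication by projections along compact spaces, which
    preserve closedness; hence any group interpreted in [K] by systems of ring
    equations is *-closed. No continuity of the operations, and no separation of
    the quotient sorts, is needed for this.

    (i) Take the group of the [3 x 3] matrices over [K] that are invertible for
    [M o N = M + N + M N] (i.e. the [1 + M] in [GL_3], which makes sense without
    an identity), and a normal solvable subgroup [N] of finite index. Since
    [[e_ij(a), e_jk(b)] = e_ik(a b)], the [a] all of whose elementary matrices
    lie in [N] form a subring of finite index, in which the products of [2 ^ n]
    elements vanish if [N] has derived length [n].

    (ii) Take the Heisenberg group over [K] and an abelian subgroup [N] of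
    finite index. The [x] with [(x, 0, 0)] and [(0, x, 0)] in [N] form a subring
    of finite index with zero multiplication.

    In both cases, by Lewin's theorem, a subring of finite index contains an
    ideal of finite index. *)

Set Implicit Arguments.
Unset Strict Implicit.
Unset Printing Implicit Defensive.

Import GRing.Theory.
Local Open Scope classical_set_scope.
Local Open Scope ring_scope.

(** * Subrings of finite index *)

(** Finite index is tracked by maps with finite range; the values of [c] at finitely many transforms
    of [x] give another such map. *)
Lemma finite_range_map (U V W T : Type) (c : V -> T) (f : U -> W -> V)
    (s : seq U) :
  finite_set (range c) -> finite_set (range (fun x => [seq c (f i x) | i <- s])).
Proof.
move=> finc; elim: s => [|i s IHs] /=.
  by apply: (@sub_finite_set _ _ [set [::]]); [move=> _ [x _ <-]|].
apply: (@sub_finite_set _ _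
  ((fun p => p.1 :: p.2) @`
     (range c `*` range (fun x => [seq c (f j x) | j <- s])))).
  by move=> _ [x _ <-]; exists (c (f i x), [seq c (f j x) | j <- s]).
by apply: finite_image; apply: finite_setX.
Qed.

Section NonUnitalRingTheory.
Variable K : nonUnitalRingType.
Implicit Types (x y z : K) (A I J : set K).

Lemma numul0r x : numul 0 x = 0.
Proof. by apply: (addrI (numul 0 x)); rewrite -numulDl !addr0. Qed.

Lemma numulr0 x : numul x 0 = 0.
Proof. by apply: (addrI (numul x 0)); rewrite -numulDr !addr0. Qed.

Lemma numulNr x y : numul (- x) y = - numul x y.
Proof. by apply: (addrI (numul x y)); rewrite -numulDl !subrr numul0r. Qed.

Lemma numulrN x y : numul x (- y) = - numul x y.
Proof. by apply: (addrI (numul x y)); rewrite -numulDr !subrr numulr0. Qed.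

Lemma numul_suml (I : Type) (r : seq I) (F : I -> K) x :
  numul (\sum_(i <- r) F i) x = \sum_(i <- r) numul (F i) x.
Proof.
exact: (big_morph (numul^~ x) (fun a b => numulDl a b x) (numul0r x)).
Qed.

Lemma numul_sumr (I : Type) (r : seq I) (F : I -> K) x :
  numul x (\sum_(i <- r) F i) = \sum_(i <- r) numul x (F i).
Proof. exact: (big_morph (numul x) (numulDr x) (numulr0 x)). Qed.

Lemma ideal_mul_min A I J :
  additive_subgroup A -> (forall x y, I x -> J y -> A (numul x y)) ->
  ideal_mul I J `<=` A.
Proof.
move=> sgA AP; apply: smallest_sub => // z [x Ix [y Jy <-]]; exact: AP.
Qed.

Lemma ideal_mul_subgroup I J : additive_subgroup (ideal_mul I J).
Proof.
split=> [A [[]] //|x y xIJ yIJ A AP|x xIJ A AP].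
  by case: (AP) => -[_ + _] _; apply; [apply: xIJ|apply: yIJ].
by case: (AP) => -[_ _ +] _; apply; apply: xIJ.
Qed.

Lemma mem_ideal_mul I J x y : I x -> J y -> ideal_mul I J (numul x y).
Proof. by move=> Ix Jy A [_]; apply; exists x => //; exists y. Qed.

Lemma ideal_mulA I J A :
  ideal_mul (ideal_mul I J) A `<=` ideal_mul I (ideal_mul J A).
Proof.
apply: ideal_mul_min => [|x y xIJ yA]; first exact: ideal_mul_subgroup.
have [B0 BD BN] := ideal_mul_subgroup I (ideal_mul J A).
(* With [y] fixed, the left factors whose product with [y] lands in the target form an additive
   subgroup, so generators suffice. *)
pose B := [set z | ideal_mul I (ideal_mul J A) (numul z y)].
suff : ideal_mul I J `<=` B by exact.
apply: ideal_mul_min => [|a b aI bJ].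
  split=> [|a b aB bB|a aB]; rewrite /B /= ?numul0r ?numulDl ?numulNr //.
    exact: BD.
  exact: BN.
by rewrite /B /= -numulA; do 2!apply: mem_ideal_mul => //.
Qed.

Lemma ideal_mulSl I I' J : I `<=` I' -> ideal_mul I J `<=` ideal_mul I' J.
Proof.
move=> sII'; apply: ideal_mul_min => [|x y Ix Jy]; first exact: ideal_mul_subgroup.
by apply: mem_ideal_mul => //; apply: sII'.
Qed.

(* The [n]-th iterate is the power [n + 1], whence the shift. *)
Lemma ideal_powD I m n :
  iter (m + n).+1 (fun J => ideal_mul J I) I `<=`
  ideal_mul (iter m (fun J => ideal_mul J I) I)
            (iter n (fun J => ideal_mul J I) I).
Proof.
elim: n => [|n IHn]; first by rewrite addn0.
rewrite addnS iterS; apply: subset_trans (@ideal_mulA _ _ _).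
exact: ideal_mulSl.
Qed.

Lemma xget_preimage (T : Type) (c : K -> T) x :
  c (xget 0 [set y | c y = c x]) = c x.
Proof. by rewrite (@xgetPex _ 0 [set y | c y = c x])//; exists x. Qed.

(** A colouring [c] with finitely many colours, each contained in a single coset, bounds the number
    of cosets. *)
Lemma separated_finite_index A (T : Type) (c : K -> T) :
  additive_subgroup A -> finite_set (range c) ->
  (forall x y, c x = c y -> A (x - y)) -> finite_index_ideal A.
Proof.
move=> sgA finc cA; pose pre t := xget 0 [set x | c x = t].
pose coset x : set K := [set x + h | h in A].
apply: (@sub_finite_set _ _ ((coset \o pre) @` range c)); last first.
  exact: finite_image.
move=> _ [x _ <-]; exists (c x); first by exists x.
have Apx : A (pre (c x) - x) by apply/cA/xget_preimage.
have [_ AD AN] := sgA.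
apply/seteqP; split=> _ [h Ah <-] /=.
  exists (pre (c x) - x + h); first exact: AD.
  by rewrite addrA [x + _]addrC subrK.
exists (x - pre (c x) + h); first by apply: AD => //; rewrite -opprB; apply: AN.
by rewrite addrA [pre _ + _]addrC subrK.
Qed.

Section FiniteIndex.
Variables (A : set K) (T : Type) (c : K -> T).
Hypotheses (sgA : additive_subgroup A) (finc : finite_set (range c)).
Hypothesis cA : forall x y, c x = c y -> A (x - y).

(** Supplies finitely many elements to stand in for arbitrary multipliers modulo [A]. *)
Lemma separated_representatives :
  exists rs : seq K, forall x, exists2 r, r \in rs & A (x - r).
Proof.
pose pre t := xget 0 [set x | c x = t].
have /finite_seqP[rs prers] : finite_set (pre @` range c).
  exact: finite_image.
exists rs => x; exists (pre (c x)).
  suff : (pre @` range c) (pre (c x)) by rewrite prers.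
  by exists (c x) => //; exists x.
exact/cA/esym/xget_preimage.
Qed.

(* Two-sided multiplication with optional factors, so that the largest ideal
   contained in [A] is [[set x | forall lr, A (sandwich lr x)]]. *)
Definition lmul_opt (l : option K) x := if l is Some a then numul a x else x.
Definition rmul_opt (r : option K) x := if r is Some a then numul x a else x.
Definition sandwich (lr : option K * option K) x :=
  lmul_opt lr.1 (rmul_opt lr.2 x).

Lemma sandwichD lr x y : sandwich lr (x + y) = sandwich lr x + sandwich lr y.
Proof.
by case: lr => [[l|] [r|]]; rewrite /sandwich /= ?(numulDl, numulDr).
Qed.

Lemma sandwichN lr x : sandwich lr (- x) = - sandwich lr x.
Proof.
by case: lr => [[l|] [r|]]; rewrite /sandwich /= ?(numulNr, numulrN).
Qed.

Lemma sandwich0 lr : sandwich lr 0 = 0.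
Proof. by apply: (addrI (sandwich lr 0)); rewrite -sandwichD !addr0. Qed.

(* Lewin's theorem: once [x], [l x] and [x r] lie in the subring [A], the
   class of [l x r] modulo [A] only depends on those of [l] and [r]. *)
Lemma finite_index_subring_ideal :
  (forall x y, A x -> A y -> A (numul x y)) ->
  exists I, [/\ ideal I, I `<=` A & finite_index_ideal I].
Proof.
move=> AM; pose I := [set x | forall lr, A (sandwich lr x)].
have [A0 AD AN] := sgA.
have sgI : additive_subgroup I.
  split=> [lr|x y Ix Iy lr|x Ix lr]; first by rewrite sandwich0.
    by rewrite sandwichD; apply: AD.
  by rewrite sandwichN; apply: AN.
exists I; split=> [||].
- split=> // a x Ix; split=> -[l r].
    rewrite (_ : sandwich _ _ = sandwich (Some (lmul_opt l a), r) x) //.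
    by case: l r => [l|] [r|]; rewrite /sandwich /= ?numulA.
  rewrite (_ : sandwich _ _ = sandwich (l, Some (rmul_opt r a)) x) //.
  by case: l r => [l|] [r|]; rewrite /sandwich /= ?numulA.
- by move=> x /(_ (None, None)).
have [rs rsP] := separated_representatives.
(* [None] is an absent factor; [d] records the colours of all sandwiches whose factors are absent or
   representatives. *)
pose os := None :: map Some rs; pose s := [seq (l, r) | l <- os, r <- os].
pose d x := [seq c (sandwich lr x) | lr <- s].
have findx : finite_set (range d) by exact: finite_range_map.
have dP x y : d x = d y -> I (x - y).
  move=> /eq_in_map dxy; set z := x - y.
  have Arep l r : l \in os -> r \in os -> A (sandwich (l, r) z).
    move=> los ros; rewrite sandwichD sandwichN; apply: cA; apply: dxy.
    by apply/allpairsP; exists (l, r).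
  have No : None \in os by rewrite inE.
  have So a : a \in rs -> Some a \in os by move=> ?; rewrite inE /= map_f.
  (* The right factor is freed first: with [a] representing [r], [l z r = l z a + (l z) (r - a)].
     Then the left one, by [l z r = a z r + (l - a) (z r)] with [a] representing [l]. *)
  have Al l r : l \in os -> A (sandwich (l, r) z).
    move=> los; case: r => [r|]; last exact: Arep.
    have [a ars Ara] := rsP r.
    rewrite (_ : sandwich _ _ =
      sandwich (l, Some a) z + numul (sandwich (l, None) z) (r - a)).
      by apply: AD; [apply: Arep => //; apply: So|apply: AM => //; apply: Arep].
    case: l {los} => [l|]; rewrite /sandwich /= -?numulA -?numulDr;
    by rewrite [a + _]addrC subrK.
  case=> -[l|] r; last exact: Al.
  have [a ars Ala] := rsP l.
  rewrite (_ : sandwich _ _ =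
    sandwich (Some a, r) z + numul (l - a) (sandwich (None, r) z)).
    by apply: AD; [apply: Al; apply: So|apply: AM => //; apply: Al].
  by rewrite /sandwich /= -numulDl [a + _]addrC subrK.
exact: separated_finite_index dP.
Qed.

End FiniteIndex.
End NonUnitalRingTheory.

(** * Circle groups and Heisenberg groups *)

Section GroupTheory.
Local Open Scope group_scope.
Variable H : groupType.
Implicit Types (x y : H) (A B N : set H).

Definition lcoset N x : set H := [set x * h | h in N].

Lemma lcoset_eq N x y : subgroup N -> lcoset N x = lcoset N y -> N (y^-1 * x).
Proof.
case=> N1 _ _ eqxy; have : lcoset N x x by exists 1; rewrite ?mulg1.
by rewrite eqxy => -[h Nh <-]; rewrite mulKg.
Qed.

Lemma commutator_subgroup A B : subgroup (commutator A B).
Proof.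
split=> [N [[]] //|x y xAB yAB N NP|x xAB N NP].
  by case: (NP) => -[_ + _] _; apply; [apply: xAB|apply: yAB].
by case: (NP) => -[_ _ +] _; apply; apply: xAB.
Qed.

Lemma mem_commutator A B x y : A x -> B y -> commutator A B [~ x, y].
Proof. by move=> Ax By N [_]; apply; exists x => //; exists y. Qed.

Lemma derived_subgroup N n :
  subgroup N -> subgroup (iter n (fun A => commutator A A) N).
Proof. by case: n => //= n _; apply: commutator_subgroup. Qed.

End GroupTheory.

Section AdditiveToGroup.
Variables (K : nonUnitalRingType) (H : groupType) (I : finType) (f : I -> K -> H).
Hypothesis fD : forall i, {morph f i : x y / x + y >-> (x * y)%g}.

Lemma morph_add0 i : f i 0 = 1%g.
Proof. by apply: (mulgI (f i 0)); rewrite -fD addr0 mulg1. Qed.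

Lemma morph_addN i x : f i (- x) = (f i x)^-1%g.
Proof. by apply: (mulgI (f i x)); rewrite -fD subrr mulgV morph_add0. Qed.

Lemma preimage_subgroup (N : set H) :
  subgroup N -> additive_subgroup [set x | forall i, N (f i x)].
Proof.
case=> N1 NM NV; split=> [i|x y Nx Ny i|x Nx i].
- by rewrite morph_add0.
- by rewrite fD; apply: NM.
- by rewrite morph_addN; apply: NV.
Qed.

(** The tuple of left cosets of the [f i x] modulo [N] is a finite colouring that separates the
    classes of the preimage; Lewin's theorem then gives the ideal. *)
Lemma preimage_finite_index_ideal (N : set H) :
  subgroup N -> finite_index N ->
  (forall x y, (forall i, N (f i x)) -> (forall i, N (f i y)) ->
     forall i, N (f i (numul x y))) ->
  exists J : set K, [/\ ideal J, J `<=` [set x | forall i, N (f i x)] &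
                       finite_index_ideal J].
Proof.
move=> sgN finN NM.
apply: (@finite_index_subring_ideal _ _ _
  (fun x => [seq lcoset N (f i x) | i <- enum I])) => //.
- exact: preimage_subgroup.
- exact: finite_range_map.
- move=> x y /eq_in_map cxy i; rewrite addrC fD morph_addN; apply: lcoset_eq => //.
  by apply: cxy; rewrite mem_enum.
Qed.

End AdditiveToGroup.

Section CircleGroup.
Variable L : nonUnitalRingType.
Implicit Types x y z : L.

Definition circ x y := x + y + numul x y.

Lemma circA : associative circ.
Proof.
move=> x y z; rewrite /circ !(numulDl, numulDr) numulA -!addrA.
do 2![congr (_ + _)]; rewrite [numul y z + _]addrCA addrCA.
by do 2![congr (_ + _)]; rewrite addrCA.
Qed.

Lemma circ0r x : circ 0 x = x.
Proof. by rewrite /circ add0r numul0r addr0. Qed.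

Lemma circr0 x : circ x 0 = x.
Proof. by rewrite /circ addr0 numulr0 addr0. Qed.

Definition quasi_inverse x y := circ x y = 0 /\ circ y x = 0.

(** Made boolean so that the circle group is a subtype and inherits a choice structure. *)
Definition quasi_invertible x := `[< exists y, quasi_inverse x y >].

Lemma quasi_invertibleP x y : quasi_inverse x y -> quasi_invertible x.
Proof. by move=> xy; apply/asboolP; exists y. Qed.

Definition circle_group := {x : L | quasi_invertible x}.

HB.instance Definition _ := SubChoice.on circle_group.

Definition circle_one : circle_group :=
  Sub 0 (quasi_invertibleP (conj (circ0r 0) (circ0r 0))).

Lemma circle_mul_subproof (x y : circle_group) :
  quasi_invertible (circ (val x) (val y)).
Proof.
have /asboolP[x' [xx' x'x]] := valP x; have /asboolP[y' [yy' y'y]] := valP y.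
apply: (@quasi_invertibleP _ (circ y' x')); split.
  by rewrite circA -(circA (val x)) yy' circr0.
by rewrite circA -(circA y') x'x circr0.
Qed.

Definition circle_mul (x y : circle_group) : circle_group :=
  Sub (circ (val x) (val y)) (circle_mul_subproof x y).

Lemma circle_inv_subproof (x : circle_group) :
  exists y : circle_group, quasi_inverse (val x) (val y).
Proof.
have /asboolP[y [xy yx]] := valP x.
by exists (Sub y (quasi_invertibleP (conj yx xy))).
Qed.

Definition circle_inv (x : circle_group) := sval (cid (circle_inv_subproof x)).

Lemma circle_mulA : associative circle_mul.
Proof. by move=> x y z; apply: val_inj; rewrite /= circA. Qed.

Lemma circle_mul1g : left_id circle_one circle_mul.
Proof. by move=> x; apply: val_inj; rewrite /= circ0r. Qed.

Lemma circle_mulg1 : right_id circle_one circle_mul.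
Proof. by move=> x; apply: val_inj; rewrite /= circr0. Qed.

Lemma circle_mulVg : left_inverse circle_one circle_inv circle_mul.
Proof.
by move=> x; apply: val_inj; rewrite /circle_inv; case: cid => y [].
Qed.

Lemma circle_mulgV : right_inverse circle_one circle_inv circle_mul.
Proof.
by move=> x; apply: val_inj; rewrite /circle_inv; case: cid => y [].
Qed.

HB.instance Definition _ := isGroup.Build circle_group
  circle_mulA circle_mul1g circle_mulg1 circle_mulVg circle_mulgV.

Lemma val_circleM (x y : circle_group) :
  val (x * y)%g = circ (val x) (val y).
Proof. by []. Qed.

(** Since [x * y = y * x * [~ x, y]], it suffices that [x * y = y * x * z]; the vanishing products
    leave the ring element [x + y + x y] on both sides. *)
Lemma circle_commutator (x y z : circle_group) :
  numul (val y) (val x) = 0 -> numul (val x) (numul (val x) (val y)) = 0 ->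
  val z = numul (val x) (val y) -> [~ x, y]%g = z.
Proof.
move=> yx xxy zE; apply: (mulgI (y * x)%g); rewrite -commgC; apply: val_inj.
rewrite !val_circleM zE /circ yx addr0 numulDl xxy addr0 numulA yx numul0r.
by rewrite addr0 [val y + _]addrC.
Qed.

End CircleGroup.

(** * Matrices over a ring without identity *)

Section Matrix.
Variables (K : nonUnitalRingType) (n : nat).

Definition numatrix := 'M[K]_n.

HB.instance Definition _ := GRing.Zmodule.on numatrix.

Implicit Types M N P : numatrix.

Definition numulmx M N : numatrix :=
  \matrix_(i, j) \sum_k numul (M i k) (N k j).

Lemma numulmxA : associative numulmx.
Proof.
move=> M N P; apply/matrixP => i j; rewrite !mxE.
under eq_bigr do rewrite mxE numul_sumr.
under [RHS]eq_bigr do rewrite mxE numul_suml.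
by rewrite exchange_big; do 2!apply: eq_bigr => ? _; rewrite numulA.
Qed.

Lemma numulmxDl : left_distributive numulmx +%R.
Proof.
move=> M N P; apply/matrixP => i j; rewrite !mxE -big_split.
by apply: eq_bigr => k _; rewrite mxE numulDl.
Qed.

Lemma numulmxDr : right_distributive numulmx +%R.
Proof.
move=> M N P; apply/matrixP => i j; rewrite !mxE -big_split.
by apply: eq_bigr => k _; rewrite mxE numulDr.
Qed.

HB.instance Definition _ :=
  Zmodule_isNonUnitalRing.Build numatrix numulmxA numulmxDl numulmxDr.

(** This is [a E_ij], given entrywise because [E_ij] itself would require an identity in [K]. *)
Definition unit_mx (i j : 'I_n) (a : K) : numatrix :=
  \matrix_(k, l) (if (k == i) && (l == j) then a else 0).

Lemma unit_mxD i j : {morph unit_mx i j : a b / a + b}.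
Proof.
by move=> a b; apply/matrixP => k l; rewrite !mxE; case: ifP; rewrite ?addr0.
Qed.

Lemma unit_mx0 i j : unit_mx i j 0 = 0.
Proof. by apply/matrixP => k l; rewrite !mxE if_same. Qed.

Lemma numul_unit_mx i j k a b :
  numul (unit_mx i j a) (unit_mx j k b) = unit_mx i k (numul a b).
Proof.
apply/matrixP => p q; rewrite !mxE (bigD1 j)//= big1 ?addr0 => [|l /negPf lj].
  by rewrite !mxE !eqxx andbT; case: (p == i); case: (q == k);
     rewrite /= ?(numul0r, numulr0).
by rewrite !mxE lj andbF numul0r.
Qed.

Lemma numul_unit_mx0 i j k l a b :
  j != k -> numul (unit_mx i j a) (unit_mx k l b) = 0.
Proof.
move=> /negPf jk; apply/matrixP => p q; rewrite !mxE big1 // => r _; rewrite !mxE.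
case: (eqVneq r j) => [->|]; first by rewrite jk /= numulr0.
by rewrite andbF numul0r.
Qed.

Lemma circ_unit_mx i j a b : i != j ->
  circ (unit_mx i j a) (unit_mx i j b) = unit_mx i j (a + b).
Proof.
by move=> ij; rewrite /circ numul_unit_mx0 1?eq_sym// addr0 unit_mxD.
Qed.

(** Formally [1 + a E_ij]. For [i != j] the default of [insubd] is never reached, since [- a] then
    yields a quasi-inverse. *)
Definition elem_mx (i j : 'I_n) (a : K) : circle_group numatrix :=
  insubd (1%g : circle_group numatrix) (unit_mx i j a).

Lemma val_elem_mx i j a : i != j -> val (elem_mx i j a) = unit_mx i j a.
Proof.
move=> ij; apply: insubdK; apply: (@quasi_invertibleP _ _ (unit_mx i j (- a))).
by split; rewrite circ_unit_mx// ?subrr ?addNr unit_mx0.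
Qed.

Lemma elem_mxD i j : i != j ->
  {morph elem_mx i j : a b / a + b >-> (a * b)%g}.
Proof.
move=> ij a b; apply: val_inj.
by rewrite val_circleM !val_elem_mx// circ_unit_mx.
Qed.

Lemma elem_mx_eq1 i j a : i != j -> elem_mx i j a = 1%g -> a = 0.
Proof.
move=> ij /(congr1 val); rewrite val_elem_mx// => /matrixP/(_ i j).
by rewrite !mxE !eqxx.
Qed.

Lemma elem_mx_commutator i j k a b : i != j -> j != k -> i != k ->
  [~ elem_mx i j a, elem_mx j k b]%g = elem_mx i k (numul a b).
Proof.
move=> ij jk ik; apply: circle_commutator.
- by rewrite !val_elem_mx// numul_unit_mx0// eq_sym.
- by rewrite !val_elem_mx// numul_unit_mx numul_unit_mx0// eq_sym.
- by rewrite !val_elem_mx// numul_unit_mx.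
Qed.

End Matrix.

(** * From derived length to nilpotency *)

Section SolvableByFinite.
Variable K : nonUnitalRingType.

(** The reason for size 3: each off-diagonal position [(i, k)] needs a middle index for the
    commutator identity. *)
Let third_index (i k : 'I_3) : exists2 j : 'I_3, i != j & j != k.
Proof.
have /card_gt0P[j] : (0 < #|[predC pred2 i k]|)%N.
  by rewrite -(ltn_add2l #|pred2 i k|) cardC card_ord card2 addn0; case: (i != k).
by rewrite inE /= negb_or eq_sym => /andP[ij jk]; exists j.
Qed.

Lemma circle_group_solvable_by_finite :
  solvable_by_finite (circle_group (numatrix K 3)) -> nilpotent_by_finite K.
Proof.
case=> N [[sgN _] [n Nn1] finN].
set D := (X in iter _ X) in Nn1.
pose f (p : {p : 'I_3 * 'I_3 | p.1 != p.2}) := @elem_mx K 3 (val p).1 (val p).2.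
have fD p : {morph f p : x y / x + y >-> (x * y)%g} by apply: elem_mxD; exact: (valP p).
pose Q m := [set a | forall p, iter m D N (f p a)].
(* A product gains one derived step, because each of its elementary matrices is a commutator. *)
have QM m x y : Q m x -> Q m y -> Q m.+1 (numul x y).
  move=> Qx Qy [[i k] ik]; have [j ij jk] := third_index i k.
  rewrite /f /= -(elem_mx_commutator _ _ ij jk ik); apply: mem_commutator.
    exact: (Qx (exist _ (i, j) ij)).
  exact: (Qy (exist _ (j, k) jk)).
have sgQ m : additive_subgroup (Q m).
  exact/(preimage_subgroup fD)/derived_subgroup.
have [|J [idJ sJQ finJ]] := preimage_finite_index_ideal fD sgN finN.
  move=> x y Qx Qy p; suff : commutator N N `<=` N by apply; apply: (QM 0).
  have [_ NM NV] := sgN; apply: smallest_sub => // _ [a Na [b Nb <-]].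
  by apply/NM; [exact: NV|apply/NM; [exact: NV|exact: NM]].
(* Iterate number [k] is the power [k + 1], so this index stands for the power [2 ^ n]; each derived
   step doubles the exponent. *)
exists J; split=> //; exists (2 ^ n).-1.
have sPQ m : iter (2 ^ m).-1 (fun A => ideal_mul A J) J `<=` Q m.
  elim: m => [|m IHm] //.
  have -> : (2 ^ m.+1).-1 = ((2 ^ m).-1 + (2 ^ m).-1).+1.
    by rewrite expnS mul2n -addnn -{1 2}(prednK (expn_gt0 2 m : 0 < 2 ^ m)%N) addSn addnS.
  apply: subset_trans (@ideal_powD _ _ _ _) _; apply: ideal_mul_min => // x y Px Py.
  by apply: QM; apply: IHm.
(* The [n]-th derived subgroup is trivial, and a single off-diagonal position, the corner, already
   forces [x = 0]. *)
apply/seteqP; split=> [x /sPQ/(_ (exist _ (ord0, ord_max) isT))|_ ->].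
  by rewrite Nn1 => /elem_mx_eq1; apply.
case: (2 ^ n).-1 => [|m] /=; first by case: idJ => -[].
by case: (ideal_mul_subgroup (iter m (fun A => ideal_mul A J) J) J).
Qed.

End SolvableByFinite.

Section Heisenberg.
Variable K : nonUnitalRingType.

(** [(a, b, c)] stands for the unitriangular [3 x 3] matrix with [a], [b] above the diagonal and [c]
    in the corner. *)
Definition heisenberg := (K * K * K)%type.

HB.instance Definition _ := Choice.on heisenberg.

Implicit Types h : heisenberg.

Definition heis_mul h h' : heisenberg :=
  (h.1.1 + h'.1.1, h.1.2 + h'.1.2, h.2 + h'.2 + numul h.1.1 h'.1.2).

Definition heis_one : heisenberg := (0, 0, 0).

Definition heis_inv h : heisenberg :=
  (- h.1.1, - h.1.2, numul h.1.1 h.1.2 - h.2).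

Lemma heis_mulA : associative heis_mul.
Proof.
move=> [[a b] c] [[a' b'] c'] [[a'' b''] c'']; rewrite /heis_mul /= !addrA.
congr (_, _, _); rewrite numulDl numulDr -!addrA; do 2![congr (_ + _)].
by rewrite [RHS]addrCA; congr (_ + _); rewrite addrC -addrA.
Qed.

Lemma heis_mul1g : left_id heis_one heis_mul.
Proof.
by move=> [[a b] c]; rewrite /heis_mul /= !add0r numul0r addr0.
Qed.

Lemma heis_mulg1 : right_id heis_one heis_mul.
Proof.
by move=> [[a b] c]; rewrite /heis_mul /= !addr0 numulr0 addr0.
Qed.

Lemma heis_mulVg : left_inverse heis_one heis_inv heis_mul.
Proof.
by move=> [[a b] c]; rewrite /heis_mul /= !addNr subrK numulNr subrr.
Qed.

Lemma heis_mulgV : right_inverse heis_one heis_inv heis_mul.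
Proof.
move=> [[a b] c]; rewrite /heis_mul /= !subrr numulrN.
by rewrite [c + _]addrC subrK subrr.
Qed.

HB.instance Definition _ := isGroup.Build heisenberg
  heis_mulA heis_mul1g heis_mulg1 heis_mulVg heis_mulgV.

Lemma heis_mulE h h' : (h * h')%g =
  (h.1.1 + h'.1.1, h.1.2 + h'.1.2, h.2 + h'.2 + numul h.1.1 h'.1.2).
Proof. by []. Qed.

Lemma heis_central (c : K) h (z : heisenberg := (0, 0, c)) :
  (z * h = h * z)%g.
Proof.
by rewrite !heis_mulE /= !addr0 !add0r numul0r numulr0 !addr0 addrC.
Qed.

Lemma heisenberg_nilpotent : nilpotent_group heisenberg.
Proof.
pose Z : set heisenberg := [set h | h.1 = (0, 0)].
have sgZ : subgroup Z.
  split=> [//|[[a b] c] [[a' b'] c'] [-> ->] [-> ->]|[[a b] c] [-> ->]].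
    by rewrite /Z /= !addr0.
  by rewrite /Z /= !oppr0.
have sg1 : subgroup [set 1%g : heisenberg].
  by split=> [//|_ _ -> ->|_ ->]; rewrite /= ?mulg1 ?invg1.
(* Class two: the first commutator step lands in [Z], whose elements are central, so the second is
   trivial. *)
exists 2; apply/seteqP; split=> [|_ ->] /=; last first.
  by case: (commutator_subgroup (commutator [set: heisenberg] setT) setT).
apply: smallest_sub => // _ [z zC [h _ <-]].
have {zC} : Z z.
  move: z zC; apply: smallest_sub => // _ [x _ [y _ <-]].
  (* The first two coordinates of [x * y = y * x * [~ x, y]] cancel, leaving those of the commutator
     zero. *)
  have := commgC x y; set w := [~ x, y]%g; rewrite !heis_mulE /Z /= => -[].
  rewrite [y.1.1 + _]addrC [y.1.2 + _]addrC.
  rewrite -{1}[x.1.1 + _]addr0 => /addrI <-.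
  by rewrite -{1}[x.1.2 + _]addr0 => /addrI <-.
case: z => [[a b] c] [-> ->] /=.
apply: (mulgI (h * ((0, 0, c) : heisenberg))%g).
by rewrite -commgC mulg1 heis_central.
Qed.

Lemma heisenberg_abelian_by_finite :
  abelian_by_finite heisenberg -> null_by_finite K.
Proof.
case=> N [[sgN _] abN finN].
pose f (b : bool) (x : K) : heisenberg := if b then (x, 0, 0) else (0, x, 0).
have fD b : {morph f b : x y / x + y >-> (x * y)%g}.
  by move=> x y; case: b; rewrite /f heis_mulE /= !addr0 ?(numul0r, numulr0) ?addr0.
(* The two products of [(x, 0, 0)] and [(0, y, 0)] differ only by [x y] in the third coordinate. *)
have NM0 x y : (forall b, N (f b x)) -> (forall b, N (f b y)) -> numul x y = 0.
  move=> Nx Ny; have := abN _ _ (Nx true) (Ny false).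
  by rewrite !heis_mulE /= !(addr0, add0r, numul0r) => -[].
have sgP := preimage_subgroup fD sgN.
have [|J [idJ sJ finJ]] := preimage_finite_index_ideal fD sgN finN.
  by move=> x y Nx Ny b; rewrite NM0//; case: sgP.
exists J; split=> //; apply/seteqP; split=> [|_ ->]; last first.
  by case: (ideal_mul_subgroup J J).
apply: ideal_mul_min => [|x y /sJ Nx /sJ Ny]; last exact: NM0.
by split=> [//|_ _ -> ->|_ ->]; rewrite /= ?addr0 ?oppr0.
Qed.

End Heisenberg.

(** * Closed invariant sets defined by ring terms *)

Section Continuity.
Variables T U V : topologicalType.

Lemma continuous_pair (f : T -> U) (g : T -> V) :
  continuous f -> continuous g -> continuous (fun x => (f x, g x)).
Proof. by move=> cf cg x; apply: cvg_pair; [apply: cf|apply: cg]. Qed.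

Lemma continuous_fst (f : T -> U * V) :
  continuous f -> continuous (fun x => (f x).1).
Proof. by move=> cf x; apply: cvg_comp (cf x) _; exact: cvg_fst. Qed.

Lemma continuous_snd (f : T -> U * V) :
  continuous f -> continuous (fun x => (f x).2).
Proof. by move=> cf x; apply: cvg_comp (cf x) _; exact: cvg_snd. Qed.

Lemma continuous_id : continuous (fun x : T => x).
Proof. by move=> x; apply: cvg_id. Qed.

(** Tube lemma: if the fibre over [t] misses [D], compactness of [U] gives a neighbourhood of [t]
    over which all fibres miss [D]. *)
Lemma closed_projection (D : set (T * U)) :
  compact [set: U] -> closed D -> closed [set t | exists s, D (t, s)].
Proof.
move=> /compact_near_coveringP cU cD t tD; apply: contrapT => nDt.
have nearD : \near t, [set: U] `<=` (fun s => ~ D (t, s)).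
  apply: (cU _ (nbhs t) (fun t s => ~ D (t, s))) => s _.
  have : nbhs (t, s) (~` D).
    by apply: open_nbhs_nbhs; split; [exact: closed_openC|move=> ?; apply: nDt; exists s].
  move=> [[A B] /= [At Bs] AB]; exists (B, A) => // -[s' t'] /= [Bs' At'].
  exact: (AB (t', s')).
have [t' [[s Dts] /(_ s I)]] := tD _ nearD; exact.
Qed.
End Continuity.

Ltac solve_continuous :=
  repeat first [ assumption
               | apply: continuous_pair
               | apply: continuous_id
               | apply: continuous_fst
               | apply: continuous_snd ].

Section InvariantClosed.
Variables (G : topGroupType) (P : set G).

Definition prod_act (T U : Type) (aT : G -> T -> T) (aU : G -> U -> U) (g : G)
    (p : T * U) : T * U := (aT g p.1, aU g p.2).

(** [closed_over] with an arbitrary [P], later the stabilizer of all parameters at once. *)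
Definition closed_inv (T : topologicalType) (aT : G -> T -> T) (D : set T) :=
  closed D /\ (forall g x, P g -> D x -> D (aT g x)).

Lemma closed_invI (T : topologicalType) (aT : G -> T -> T) (D E : set T) :
  closed_inv aT D -> closed_inv aT E -> closed_inv aT (D `&` E).
Proof.
move=> [cD iD] [cE iE]; split=> [|g x Pg [Dx Ex]]; first exact: closedI.
by split; [apply: iD|apply: iE].
Qed.

Lemma closed_inv_forall (T : topologicalType) (aT : G -> T -> T) (V : Type)
    (D : V -> set T) :
  (forall v, closed_inv aT (D v)) -> closed_inv aT [set t | forall v, D v t].
Proof.
move=> DP; split=> [|g x Pg Dx v]; last by apply: (DP v).2.
rewrite (_ : mkset _ = \bigcap_v D v); first by apply: closed_bigI => v _; apply: (DP v).1.
by apply/seteqP; split=> t Dt v //; apply: Dt.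
Qed.

Lemma closed_inv_preimage (T U : topologicalType) (aT : G -> T -> T)
    (aU : G -> U -> U) (f : T -> U) (D : set U) :
  continuous f -> (forall g x, f (aT g x) = aU g (f x)) ->
  closed_inv aU D -> closed_inv aT (f @^-1` D).
Proof.
move=> cf fe [cD iD]; split=> [|g x Pg Dx /=]; last by rewrite fe; apply: iD.
by apply: preimage_closed => // x _; apply: cf.
Qed.

Lemma closed_inv_exists (T U : topologicalType) (aT : G -> T -> T)
    (aU : G -> U -> U) (D : set (T * U)) :
  compact [set: U] -> closed_inv (prod_act aT aU) D ->
  closed_inv aT [set t | exists s, D (t, s)].
Proof.
move=> cU [cD iD]; split=> [|g x Pg [s Ds]]; first exact: closed_projection.
by exists (aU g s); apply: (iD g (x, s)).
Qed.

Section Interpretation.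
Variables (S : topologicalType) (aS : G -> S -> S).
Hypothesis cS : compact [set: S].
Variables (K : nonUnitalRingType) (u : K -> S).
Hypothesis u_inj : injective u.
Hypothesis uU : closed_inv aS (range u).
Hypothesis uD : closed_inv (diag3 aS) (op_graph u +%R).
Hypothesis uM : closed_inv (diag3 aS) (op_graph u numul).

(** Off the range of [u] this is the default 0, which is why later sets carry the condition
    [encoded]. *)
Definition ring_decode (s : S) : K := xget 0 [set x | u x = s].

Lemma ring_encodeK : cancel u ring_decode.
Proof.
move=> x; apply: u_inj; rewrite /ring_decode.
by rewrite (@xgetPex _ 0 [set y | u y = u x])//; exists x.
Qed.

Lemma ring_decodeK s : range u s -> u (ring_decode s) = s.
Proof. by case=> x _ <-; rewrite ring_encodeK. Qed.

Section Terms.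
Variable V : Type.

(* The ring terms without constants other than 0, in variables from [V]. *)
Inductive term_fun : ((V -> K) -> K) -> Prop :=
| term_var v : term_fun (fun r => r v)
| term_zero : term_fun (fun _ => 0)
| term_add F F' : term_fun F -> term_fun F' -> term_fun (fun r => F r + F' r)
| term_mul F F' :
    term_fun F -> term_fun F' -> term_fun (fun r => numul (F r) (F' r)).

Lemma term_sum (I : Type) (s : seq I) (F : I -> (V -> K) -> K) :
  (forall i, term_fun (F i)) -> term_fun (fun r => \sum_(i <- s) F i r).
Proof.
move=> FP; elim: s => [|i s IHs].
  under eq_fun do rewrite big_nil; exact: term_zero.
by under eq_fun do rewrite big_cons; apply: term_add.
Qed.

Variables (T : topologicalType) (aT : G -> T -> T) (pt : V -> T -> S).
Hypothesis pt_cont : forall v, continuous (pt v).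
Hypothesis pt_act : forall v g t, pt v (aT g t) = aS g (pt v t).

Definition env (t : T) (v : V) : K := ring_decode (pt v t).

Definition encoded : set T := [set t | forall v, range u (pt v t)].

Lemma encoded_closed_inv : closed_inv aT encoded.
Proof. by apply: closed_inv_forall => v; apply: closed_inv_preimage uU. Qed.

(** Zero is the only solution of [x + x = x], so this point is closed because the graph of addition
    is. *)
Lemma closed_inv_zero : closed_inv aS [set u 0].
Proof.
rewrite (_ : [set u 0] = (fun s => (s, s, s)) @^-1` op_graph u +%R).
  by apply: closed_inv_preimage uD => //; solve_continuous.
apply/seteqP; split=> [_ ->|s [x [y [sx sy sxy]]]] /=.
  by exists 0, 0; rewrite addr0.
have <- : y = 0; last by [].
by apply: (addrI x); apply: u_inj; rewrite addr0 -sxy.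
Qed.

(* Equality of elements of the range is expressed through the graph of
   addition, so that [S] need not be Hausdorff. *)
Lemma closed_inv_range_eq :
  closed_inv (prod_act aS aS) [set p | range u p.1 /\ p.1 = p.2].
Proof.
rewrite (_ : mkset _ = [set p | exists z,
  ((fun q => q.2) @^-1` [set u 0] `&`
   (fun q => (q.1.1, q.2, q.1.2)) @^-1` op_graph u +%R) (p, z)]).
  apply: (closed_inv_exists (aU := aS)) => //; apply: closed_invI.
    by apply: closed_inv_preimage closed_inv_zero => //; solve_continuous.
  by apply: closed_inv_preimage uD => //; solve_continuous.
apply/seteqP; split=> -[s s'] /=.
  by move=> [[x _ <-] <-]; exists (u 0); split=> //; exists x, 0; rewrite addr0.
move=> [_ [->]] [x [y [-> /u_inj <- ->]]]; rewrite addr0; split=> //; by exists x.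
Qed.

(** The values of both arguments are quantified over the compact space [S * S], which leaves three
    closed invariant conditions. *)
Lemma closed_inv_op (op : K -> K -> K) F F' :
  closed_inv (diag3 aS) (op_graph u op) ->
  closed_inv (prod_act aT aS) [set p | encoded p.1 /\ p.2 = u (F (env p.1))] ->
  closed_inv (prod_act aT aS) [set p | encoded p.1 /\ p.2 = u (F' (env p.1))] ->
  closed_inv (prod_act aT aS)
    [set p | encoded p.1 /\ p.2 = u (op (F (env p.1)) (F' (env p.1)))].
Proof.
move=> uop FP F'P.
set DF := mkset _ in FP; set DF' := mkset _ in F'P.
rewrite (_ : mkset _ = [set p | exists z : S * S,
  ((fun q => (q.1.1, q.2.1)) @^-1` DF `&`
   (fun q => (q.1.1, q.2.2)) @^-1` DF' `&`
   (fun q => (q.2.1, q.2.2, q.1.2)) @^-1` op_graph u op) (p, z)]).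
  apply: (closed_inv_exists (aU := prod_act aS aS)).
    by rewrite -setXTT; apply: compact_setX.
  apply: closed_invI; [apply: closed_invI|].
  - by apply: closed_inv_preimage FP => //; solve_continuous.
  - by apply: closed_inv_preimage F'P => //; solve_continuous.
  - by apply: closed_inv_preimage uop => //; solve_continuous.
apply/seteqP; split=> -[t s] /=.
  move=> [et ->]; exists (u (F (env t)), u (F' (env t))); split=> //.
  by exists (F (env t)), (F' (env t)).
move=> [[z z']] [[[/= et ->] [/= _ ->]]] /= [x [y [/u_inj -> /u_inj -> ->]]].
by split.
Qed.

Lemma closed_inv_term F : term_fun F ->
  closed_inv (prod_act aT aS) [set p | encoded p.1 /\ p.2 = u (F (env p.1))].
Proof.
have encP : closed_inv (prod_act aT aS) [set p | encoded p.1].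
  by apply: closed_inv_preimage encoded_closed_inv => //; solve_continuous.
elim=> {F} [v||F F' _ FP _ F'P|F F' _ FP _ F'P].
- rewrite (_ : mkset _ = [set p | encoded p.1] `&`
    (fun p => (pt v p.1, p.2)) @^-1` [set p | range u p.1 /\ p.1 = p.2]).
    apply: closed_invI => //; apply: closed_inv_preimage closed_inv_range_eq.
      apply: continuous_pair; last by solve_continuous.
      move=> p; apply: cvg_comp; [exact: cvg_fst|exact: pt_cont].
    by move=> g p; rewrite /prod_act /= pt_act.
  apply/seteqP; split=> -[t s] /= [et].
    by move=> ->; rewrite /env ring_decodeK //; split=> //; split=> //; apply: et.
  by move=> [ru <-]; rewrite /env ring_decodeK.
- rewrite (_ : mkset _ = [set p | encoded p.1] `&` (fun p => p.2) @^-1` [set u 0]) //.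
  apply: closed_invI => //; apply: closed_inv_preimage closed_inv_zero => //.
  by solve_continuous.
- exact: closed_inv_op.
- exact: closed_inv_op.
Qed.

(** The equation holds at [t] when the graphs of both sides share a point over [t]; this common
    value is projected away. *)
Lemma closed_inv_equation F F' : term_fun F -> term_fun F' ->
  closed_inv aT [set t | encoded t /\ F (env t) = F' (env t)].
Proof.
move=> /closed_inv_term FP /closed_inv_term F'P.
rewrite (_ : mkset _ = [set t | exists s,
  ([set p | encoded p.1 /\ p.2 = u (F (env p.1))] `&`
   [set p | encoded p.1 /\ p.2 = u (F' (env p.1))]) (t, s)]).
  by apply: (closed_inv_exists (aU := aS)) => //; apply: closed_invI.
apply/seteqP; split=> t /=.
  by move=> [et FF']; exists (u (F (env t))); rewrite FF'.
by move=> [s [[/= et ->] [_ /u_inj]]].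
Qed.
End Terms.

End Interpretation.
End InvariantClosed.

Lemma term_rename (K : nonUnitalRingType) (V W : Type) (s : V -> W)
    (F : (V -> K) -> K) :
  term_fun F -> term_fun (fun r : W -> K => F (fun v => r (s v))).
Proof.
elim=> {F} [v||F F' _ FP _ F'P|F F' _ FP _ F'P].
- exact: term_var.
- exact: term_zero.
- exact: term_add.
- exact: term_mul.
Qed.

Definition sum_env (K V W : Type) (x : V -> K) (y : W -> K) (v : V + W) : K :=
  match v with inl i => x i | inr j => y j end.

(* The group [H] is interpreted in the ring [K]: its elements are the tuples
   [x] for which the system [f e (x, y) = 0] has a solution [y], and its
   operation is given by ring terms. *)
Definition term_definable (K : nonUnitalRingType) (H : groupType) :=
  exists (I : finType) (c : H -> I -> K) (E : Type)
    (f : E -> (I + I -> K) -> K) (op : I -> (I + I -> K) -> K),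
  [/\ injective c, forall e, term_fun (f e), forall i, term_fun (op i),
      forall x, (exists h, c h = x) <->
                (exists y, forall e, f e (sum_env x y) = 0) &
      forall h h' i, c (h * h')%g i = op i (sum_env (c h) (c h'))].

(** * Closedness of interpreted groups *)

Section Transfer.
Variables (G : topGroupType) (Y : Type) (actY : G -> Y -> Y).
Variables (S S' : topologicalType) (aS : G -> S -> S) (aS' : G -> S' -> S').
Hypotheses (cS : compact [set: S]) (cS' : compact [set: S']).
Variables (I : finType) (phi : I -> S' -> S) (psi : (I -> S) -> S').
Hypothesis phi_cont : forall i, continuous (phi i).
Hypothesis phi_act : forall i g s, phi i (aS' g s) = aS g (phi i s).
Hypothesis phiK : forall f i, phi i (psi f) = f i.
Hypothesis phi_inj : forall s s', (forall i, phi i s = phi i s') -> s = s'.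
Variables (K : nonUnitalRingType) (u : K -> S).
Hypothesis uP : star_closed_ring_in actY aS u.
Variables (H : groupType) (c : H -> I -> K) (E : Type).
Variables (f : E -> (I + I -> K) -> K) (op : I -> (I + I -> K) -> K).
Hypotheses (c_inj : injective c) (fP : forall e, term_fun (f e)).
Hypothesis opP : forall i, term_fun (op i).
Hypothesis cP : forall x, (exists h, c h = x) <->
                          (exists y, forall e, f e (sum_env x y) = 0).
Hypothesis cM : forall h h' i, c (h * h')%g i = op i (sum_env (c h) (c h')).

Let u_inj : injective u. Proof. by case: uP. Qed.

Let code (x : I -> K) : S' := psi (fun i => u (x i)).

Let decode_code x i : ring_decode u (phi i (code x)) = x i.
Proof. by rewrite phiK ring_encodeK. Qed.

Let code_decode s : (forall i, range u (phi i s)) ->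
  code (fun i => ring_decode u (phi i s)) = s.
Proof. by move=> us; apply: phi_inj => i; rewrite phiK ring_decodeK. Qed.

Let range_phi_code x i : range u (phi i (code x)).
Proof. by rewrite phiK; exists (x i). Qed.

(** [S'] is the power of [S] by [I], with projections [phi] and tupling [psi]; it is kept abstract
    to cover both powers of [X] and products of sorts. *)
Lemma star_closed_group_transfer :
  star_closed_group_in actY aS' (fun h => code (c h)).
Proof.
have [_ [A1 finA1 A1P] [A2 finA2 A2P] [A3 finA3 A3P]] := uP.
pose A := A1 `|` A2 `|` A3.
have finA : finite_set A by rewrite !finite_setU.
pose P := pointwise_stabilizer actY A.
have uU : closed_inv P aS (range u).
  by split=> [|g x Pg]; [apply: A1P.1|apply: A1P.2 => a ?; apply: Pg; left; left].
have uD : closed_inv P (diag3 aS) (op_graph u +%R).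
  by split=> [|g x Pg]; [apply: A2P.1|apply: A2P.2 => a ?; apply: Pg; left; right].
have uM : closed_inv P (diag3 aS) (op_graph u numul).
  by split=> [|g x Pg]; [apply: A3P.1|apply: A3P.2 => a ?; apply: Pg; right].
have term_eqP := closed_inv_equation cS u_inj uU uD uM.
pose pt2 (v : I + I) (t : S' * S') :=
  match v with inl i => phi i t.1 | inr i => phi i t.2 end.
have pt2_cont v : continuous (pt2 v).
  case: v => i t; (apply: cvg_comp; last exact: phi_cont).
    exact: cvg_fst.
  exact: cvg_snd.
have pt2_act v g t : pt2 v (prod_act aS' aS' g t) = aS g (pt2 v t).
  by case: v => i; apply: phi_act.
have envE s s' : env u pt2 (s, s') =
    sum_env (fun i => ring_decode u (phi i s)) (fun i => ring_decode u (phi i s')).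
  by apply/funext => -[].
have rangeP : closed_inv P aS' (range (fun h => code (c h))).
  (* The universe is the projection of the solution set along the unknowns [s']. The separate
     condition [encoded] matters when [E] is empty. *)
  rewrite [X in closed_inv _ _ X](_ : _ = [set s | exists s', (encoded u pt2 `&`
    [set t | forall e, encoded u pt2 t /\ f e (env u pt2 t) = 0]) (s, s')]).
    apply: (closed_inv_exists (aU := aS')) => //; apply: closed_invI.
      exact: (encoded_closed_inv uU).
    apply: closed_inv_forall => e.
    exact: (term_eqP _ _ _ _ pt2_cont pt2_act (f e) (fun=> 0) (fP e) (term_zero _ _)).
  apply/seteqP; split=> [_ [h _ <-]|s [s' [es fs]]].
    have [y fy] : exists y, forall e, f e (sum_env (c h) y) = 0.
      by apply/cP; exists h.
    have ehy : encoded u pt2 (code (c h), code y) by move=> [] i; apply: range_phi_code.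
    exists (code y); split=> // e; split=> //; rewrite envE -[RHS](fy e).
    by congr (f e (sum_env _ _)); apply/funext => i; rewrite decode_code.
  have [h ch] : exists h, c h = (fun i => ring_decode u (phi i s)).
    apply/cP; exists (fun i => ring_decode u (phi i s')) => e.
    by rewrite -envE; apply: (fs e).2.
  by exists h => //; rewrite ch code_decode// => i; apply: (es (inl i)).
split.
- move=> h h' hh'; apply: c_inj; apply/funext => i.
  by rewrite -(decode_code (c h)) hh' decode_code.
- by exists A.
exists A => //.
(* Three tuples of variables: the two factors and, under the outer [inr], their product. *)
pose pt3 (v : I + I + I) (t : S' * S' * S') :=
  match v with inl w => pt2 w t.1 | inr i => phi i t.2 end.
have pt3_cont v : continuous (pt3 v).
  case: v => [w|i] t; (apply: cvg_comp; last by [exact: phi_cont|exact: pt2_cont]).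
    exact: cvg_fst.
  exact: cvg_snd.
have pt3_act v g t : pt3 v (diag3 aS' g t) = aS g (pt3 v t).
  by case: v => [w|i]; [apply: (pt2_act w g t.1)|apply: phi_act].
pose R := range (fun h => code (c h)).
change (closed_inv P (diag3 aS')
  (op_graph (fun h => code (c h)) (fun x y => (x * y)%g))).
rewrite [X in closed_inv _ _ X](_ : _ = (fun t => t.1.1) @^-1` R `&`
  (fun t => t.1.2) @^-1` R `&` encoded u pt3 `&`
  [set t | forall i, encoded u pt3 t /\
     env u pt3 t (inr i) = op i (fun v => env u pt3 t (inl v))]).
  apply: closed_invI; [apply: closed_invI; [apply: closed_invI|]|].
  - by apply: closed_inv_preimage rangeP => //; solve_continuous.
  - by apply: closed_inv_preimage rangeP => //; solve_continuous.
  - exact: (encoded_closed_inv uU).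
  - apply: closed_inv_forall => i.
    apply: (term_eqP _ _ _ _ pt3_cont pt3_act (fun r => r (inr i))
      (fun r => op i (fun v => r (inl v)))).
      exact: term_var.
    exact: term_rename.
have env3 s1 s2 s3 :
    (fun v => env u pt3 (s1, s2, s3) (inl v)) = env u pt2 (s1, s2) by [].
apply/seteqP; split=> [_ [h [h' ->]]|[[s1 s2] s3]].
  have ehh : encoded u pt3 (code (c h), code (c h'), code (c (h * h')%g)).
    by move=> [[]|] i; apply: range_phi_code.
  split=> [|i]; first by split=> //; split; [exists h|exists h'].
  split=> //; rewrite env3 envE [LHS]decode_code cM.
  by congr (op i (sum_env _ _)); apply/funext => j; rewrite decode_code.
move=> [[[[h _ /= <-] [h' _ /= <-]] es] ops]; exists h, h'.
congr (_, _, _); rewrite -[LHS]code_decode => [|i]; last exact: (es (inr i)).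
congr code; apply/funext => i; rewrite cM.
have [_] := ops i; rewrite env3 envE => opi; apply: etrans opi _.
by congr (op i (sum_env _ _)); apply/funext => j; rewrite decode_code.
Qed.

End Transfer.

(** * Powers of a product as products *)

Section PowerOfProduct.
Variables (G : Type) (k : nat) (T : 'I_k -> topologicalType).
Variables (a : forall i, G -> T i -> T i) (I : finType).

(** A power by [I] of a product over ['I_k] is a product over [I * 'I_k], here enumerated by an
    ordinal; this recovers the original factor. *)
Definition pow_coord (j : 'I_#|{: I * 'I_k}|) : 'I_k := (enum_val j).2.

Lemma pow_coordK i l : pow_coord (enum_rank (i, l)) = l.
Proof. by rewrite /pow_coord enum_rankK. Qed.

(** The component at [enum_rank (i, l)] has a type equal to [T l] only by [pow_coordK], hence the
    transport. *)
Definition pow_proj (i : I) (x : prod_topology (fun j => T (pow_coord j)))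
    : prod_topology T :=
  fun l => eq_rect _ (fun m => T m) (x (enum_rank (i, l))) _ (pow_coordK i l).

Definition pow_tuple (f : I -> prod_topology T)
    : prod_topology (fun j => T (pow_coord j)) :=
  fun j => f (enum_val j).1 (pow_coord j).

Lemma pow_tupleK f i : pow_proj i (pow_tuple f) = f i.
Proof.
apply: functional_extensionality_dep => l; rewrite /pow_proj /pow_tuple.
(* Once the index and its equation are generalized, the equation can be eliminated; uniqueness of
   equality proofs on ['I_k] removes the transport. *)
move: (pow_coordK i l); rewrite /pow_coord; move: (enum_val _) (enum_rankK (i, l)).
by move=> p -> /= e; rewrite (eq_irrelevance e erefl).
Qed.

Lemma pow_proj_inj x y : (forall i, pow_proj i x = pow_proj i y) -> x = y.
Proof.
move=> xy; apply: functional_extensionality_dep => j.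
have /(congr1 (fun z => z (enum_val j).2)) := xy (enum_val j).1.
rewrite /pow_proj; move: (pow_coordK _ _).
rewrite -surjective_pairing enum_valK => e.
by rewrite (eq_irrelevance e erefl).
Qed.

Lemma pow_proj_act i g x :
  pow_proj i (fun j => a g (x j)) = fun l => a g (pow_proj i x l).
Proof.
apply: functional_extensionality_dep => l; rewrite /pow_proj.
by move: (pow_coordK i l); move: (enum_rank _) => j e; case: _ / e.
Qed.

Lemma prod_topology_continuous (W : topologicalType) (h : W -> prod_topology T) :
  (forall l, continuous (fun w => h w l)) -> continuous h.
Proof.
move=> ch w; apply/cvg_sup => l U [V] [[B oB <-]] Bw BU.
apply: filterS BU _; apply: (ch l w B); exact: open_nbhs_nbhs.
Qed.

Lemma pow_proj_continuous i : continuous (pow_proj i).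
Proof.
apply: prod_topology_continuous => l; rewrite /pow_proj.
move: (pow_coordK i l); move: (enum_rank _) => j e; case: _ / e.
exact: proj_continuous.
Qed.

Lemma prod_topology_compact :
  (forall i, compact [set: T i]) -> compact [set: prod_topology T].
Proof.
move=> cT; have := tychonoff cT.
by rewrite (_ : [set f | _] = setT)//; apply/seteqP; split.
Qed.
End PowerOfProduct.

(** * Interpretations of the two groups *)

Lemma circle_group_definable (K : nonUnitalRingType) n :
  term_definable K (circle_group (numatrix K n)).
Proof.
pose I : finType := ('I_n * 'I_n)%type.
pose op (p : I) (r : I + I -> K) := r (inl p) + r (inr p) +
  \sum_(k < n) numul (r (inl (p.1, k))) (r (inr (k, p.2))).
pose swap (v : I + I) : I + I := match v with inl p => inr p | inr p => inl p end.
(* The boolean selects the order of the factors: the equations make the second matrix a two-sided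
   quasi-inverse of the first. *)
pose f (e : bool * I) := if e.1 then op e.2 else fun r => op e.2 (fun v => r (swap v)).
pose entries (M : numatrix K n) (p : I) := M p.1 p.2.
have entries_inj : injective entries.
  by move=> M N MN; apply/matrixP => i j; apply: (congr1 (fun x => x (i, j)) MN).
have opP p : term_fun (op p).
  apply: term_add; first by apply: term_add; apply: term_var.
  by apply: term_sum => k; apply: term_mul; apply: term_var.
have opE M N p : op p (sum_env (entries M) (entries N)) = entries (circ M N) p.
  by rewrite /entries /circ !mxE.
have swapE x y : (fun v => sum_env x y (swap v)) = sum_env y x :> (I + I -> K).
  by apply/funext => -[].
exists I, (entries \o val), (bool * I)%type, f, op; split=> //.
- by move=> h h' /entries_inj /val_inj.
- by case=> -[] p; [exact: opP|exact: term_rename].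
- move=> x; split=> [[h <-]|[y xy]].
    have /asboolP[N [hN Nh]] := valP h.
    exists (entries N); case=> -[] p; rewrite /f /= ?swapE opE ?hN ?Nh;
    by rewrite /entries mxE.
  pose toM (z : I -> K) : numatrix K n := \matrix_(i, j) z (i, j).
  have toMK z : entries (toM z) = z.
    by apply/funext => -[i j]; rewrite /entries mxE.
  have qx : quasi_inverse (toM x) (toM y).
    split; apply: entries_inj; apply/funext => p; rewrite -opE !toMK.
      by have := xy (true, p); rewrite /f /= => ->; rewrite /entries mxE.
    by have := xy (false, p); rewrite /f /= swapE => ->; rewrite /entries mxE.
  by exists (Sub (toM x) (quasi_invertibleP qx)); rewrite /= toMK.
- by move=> h h' p; rewrite opE.
Qed.

Lemma heisenberg_definable (K : nonUnitalRingType) :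
  term_definable K (heisenberg K).
Proof.
pose I : finType := option bool.
pose c (h : heisenberg K) (i : I) :=
  match i with Some true => h.1.1 | Some false => h.1.2 | None => h.2 end.
pose op (i : I) (r : I + I -> K) := match i with
  | None => r (inl i) + r (inr i) +
            numul (r (inl (Some true))) (r (inr (Some false)))
  | Some _ => r (inl i) + r (inr i)
  end.
(* Every triple is an element, so the system of equations is empty. *)
exists I, c, void, (fun=> fun=> 0), op; split=> //.
- move=> [[a b] z] [[a' b'] z'] cc; congr (_, _, _).
  + exact: (congr1 (fun x => x (Some true)) cc).
  + exact: (congr1 (fun x => x (Some false)) cc).
  + exact: (congr1 (fun x => x None) cc).
- case=> [b|]; do ?[apply: term_add]; do ?[exact: term_var].
  by apply: term_mul; apply: term_var.
- move=> x; split=> _; first by exists x; case.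
  exists (x (Some true), x (Some false), x None).
  by apply/funext => -[[]|].
- by move=> h h' [[]|].
Qed.

(** * Application to compact [G]-spaces *)

Section CompactGSpace.
Variables (R : realType) (X : topologicalType) (G : topGroupType).
Variables (act : G -> X -> X) (XG : compact_G_space R act).
Variables (K : nonUnitalRingType) (H : groupType).
Hypothesis KH : term_definable K H.

Lemma pow_space_compact n : compact [set: pow_space X n].
Proof. by apply: prod_topology_compact => _; apply: cgs_compact XG. Qed.

Lemma sort_space_compact (s : teq_sort act) : compact [set: sort_space s].
Proof.
pose p := \pi_(sort_space s)%qT : pow_space X (sort_arity s) -> sort_space s.
rewrite (_ : setT = p @` setT).
  apply: continuous_compact; last exact: pow_space_compact.
  by apply: continuous_subspaceT; exact: pi_continuous.
by apply/seteqP; split=> // x _; exists (repr x) => //; apply: reprK.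
Qed.

Lemma star_closed_group_definable :
  star_closed_ring act K -> star_closed_group act H.
Proof.
case: KH => I [c [E [f [op [c_inj fP opP cP cM]]]]] [n [u uP]].
(* An [I]-tuple of points of a power of [X] is a point of a larger power; the encoding comes from
   unification with the transfer lemma. *)
exists #|{: I * 'I_n}|; eexists.
apply: (star_closed_group_transfer (phi := @pow_proj n (fun=> X) I)
  (psi := @pow_tuple n (fun=> X) I) _ _ _ _ _ _ uP c_inj fP opP cP cM).
- exact: pow_space_compact.
- exact: pow_space_compact.
- exact: pow_proj_continuous.
- by move=> i g s; exact: (@pow_proj_act G n (fun=> X) (fun=> act)).
- exact: pow_tupleK.
- exact: pow_proj_inj.
Qed.

Lemma teq_star_closed_group_definable :
  teq_star_closed_ring act K -> teq_star_closed_group act H.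
Proof.
case: KH => I [c [E [f [op [c_inj fP opP cP cM]]]]] [k [s [u uP]]].
pose T i := sort_space (s i).
exists #|{: I * 'I_k}|, (fun j => s (pow_coord j)); eexists.
apply: (star_closed_group_transfer (phi := @pow_proj k T I)
  (psi := @pow_tuple k T I) _ _ _ _ _ _ uP c_inj fP opP cP cM).
- by apply: prod_topology_compact => i; apply: sort_space_compact.
- by apply: prod_topology_compact => i; apply: sort_space_compact.
- exact: pow_proj_continuous.
- by move=> i g x; exact: (@pow_proj_act G k T (fun i => @sort_act _ _ _ (s i))).
- exact: pow_tupleK.
- exact: pow_proj_inj.
Qed.
End CompactGSpace.

Theorem theorem3p3 (R : realType) (X : topologicalType) (G : topGroupType)
    (act : G -> X -> X) (XG : compact_G_space R act) :
  (((forall H : groupType, star_closed_group act H -> solvable_by_finite H) ->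
    forall K : nonUnitalRingType, star_closed_ring act K ->
      has_identity K \/ finite_characteristic K -> nilpotent_by_finite K)
   /\
   ((forall H : groupType, teq_star_closed_group act H ->
       solvable_by_finite H) ->
    forall K : nonUnitalRingType, teq_star_closed_ring act K ->
      has_identity K \/ finite_characteristic K -> nilpotent_by_finite K))
  /\
  (((forall H : groupType, star_closed_group act H -> nilpotent_group H ->
       abelian_by_finite H) ->
    forall K : nonUnitalRingType, star_closed_ring act K -> null_by_finite K)
   /\
   ((forall H : groupType, teq_star_closed_group act H -> nilpotent_group H ->
       abelian_by_finite H) ->
    forall K : nonUnitalRingType, teq_star_closed_ring act K ->
      null_by_finite K)).
Proof.
split; split=> grpP K KP.
- move=> _; apply/circle_group_solvable_by_finite/grpP.
  exact: (star_closed_group_definable XG (circle_group_definable K 3)).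
- move=> _; apply/circle_group_solvable_by_finite/grpP.
  exact: (teq_star_closed_group_definable XG (circle_group_definable K 3)).
- apply: heisenberg_abelian_by_finite; apply: grpP (heisenberg_nilpotent K).
  exact: (star_closed_group_definable XG (heisenberg_definable K)).
- apply: heisenberg_abelian_by_finite; apply: grpP (heisenberg_nilpotent K).
  exact: (teq_star_closed_group_definable XG (heisenberg_definable K)).
Qed.
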